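(* Let $A_1\in\mathbb{R}^{p\times n}$ have full column rank and $A_2\in\mathbb{R}^{q\times n}$, with $p+q=m$, let $b_1\in\mathbb{R}^p$, $b_2\in\mathbb{R}^q$, and assume that $A_1^TA_1-A_2^TA_2$ is symmetric positive definite. Then for every real $\alpha>0$ and every symmetric positive definite matrix $S\in\mathbb{R}^{n\times n}$, the BRS iterative method $\bm{u}_{k+1}=\mathcal{G}\bm{u}_k+\bm{d}$ is convergent for any initial guess $\bm{u}_0\in\mathbb{R}^{p+n+q}$; that is, the iteration matrix $\mathcal{G}=\mathscr{P}_{\mathrm{BRS}}^{-1}\mathcal{Q}_{\mathrm{BRS}}$ satisfies $\rho(\mathcal{G})<1$.
   Context: $\rho(\cdot)$ denotes the spectral radius. The indefinite least-squares problem is $\min_x (b-Ax)^T\mathcal{J}(b-Ax)$ with $A=\begin{bmatrix} A_1 \\ A_2 \end{bmatrix}\in\mathbb{R}^{m\times n}$, $b=\begin{bmatrix} b_1 \\ b_2 \end{bmatrix}$, $\mathcal{J}=\mathrm{diag}(I_p,-I_q)$; the standing assumption is that $A^T\mathcal{J}A=A_1^TA_1-A_2^TA_2$ is symmetric positive definite. The problem is rewritten as the augmented system $\mathcal{K}\bm{u}=\begin{bmatrix} b_1 \\ 0 \\ b_2 \end{bmatrix}$ with $$\mathcal{K}=\begin{bmatrix} I_p & A_1 & 0 \\ -A_1^T & 0 & A_2^T \\ 0 & A_2 & I_q \end{bmatrix}.$$ For $\alpha>0$ and $S\in\mathbb{R}^{n\times n}$ symmetric positive definite, $\mathcal{K}=\mathscr{P}_{\mathrm{BRS}}-\mathcal{Q}_{\mathrm{BRS}}$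 with $$\mathscr{P}_{\mathrm{BRS}}=\begin{bmatrix} (\alpha+1)I_p & A_1 & 0 \\ -A_1^T & S & 0 \\ 0 & A_2 & (\alpha+1)I_q \end{bmatrix},\qquad \mathcal{Q}_{\mathrm{BRS}}=\begin{bmatrix} \alpha I_p & 0 & 0 \\ 0 & S & -A_2^T \\ 0 & 0 & \alpha I_q \end{bmatrix}.$$ The BRS iterative method is $\bm{u}_{k+1}=\mathcal{G}\bm{u}_k+\bm{d}$, $k=0,1,2,\dots$, with $\mathcal{G}=\mathscr{P}_{\mathrm{BRS}}^{-1}\mathcal{Q}_{\mathrm{BRS}}$ and $\bm{d}=\mathscr{P}_{\mathrm{BRS}}^{-1}\begin{bmatrix} b_1 \\ 0 \\ b_2 \end{bmatrix}$. *)

(* Defs.v *)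
From mathcomp Require Import all_boot all_order all_algebra.
From mathcomp Require Import complex.
From mathcomp Require Import boolp classical_sets reals topology normedtype.

Set Implicit Arguments.
Unset Strict Implicit.
Unset Printing Implicit Defensive.

Import Order.TTheory GRing.Theory Num.Theory.

Local Open Scope ring_scope.

Definition sym_posdef (R : realType) (n : nat) (M : 'M[R]_n) : Prop :=
  M \is symmetricmx /\
  forall x : 'cV[R]_n, x != 0 -> 0 < (x^T *m M *m x) 0 0.

(* The eigenvalues range over the complex numbers. There are finitely many, so
   the supremum is a maximum; for k = 0 the set is empty and sup yields 0. *)
Definition spectral_radius (R : realType) (k : nat) (M : 'M[R]_k) : R :=
  sup [set r : R | exists2 a : R[i],
         eigenvalue (map_mx (real_complex R) M) a & r = ComplexField.Normc.normc a].

Section BRS.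
Variables (R : realType) (p n q : nat).

Definition augmented_mx (A1 : 'M[R]_(p, n)) (A2 : 'M[R]_(q, n)) :
    'M[R]_(p + (n + q)) :=
  block_mx 1%:M              (row_mx A1 0)
           (col_mx (- A1^T) 0) (block_mx 0  A2^T
                                         A2 1%:M).

Definition augmented_rhs (b1 : 'cV[R]_p) (b2 : 'cV[R]_q) :
    'cV[R]_(p + (n + q)) :=
  col_mx b1 (col_mx 0 b2).

Definition BRS_P (alpha : R) (S : 'M[R]_n)
    (A1 : 'M[R]_(p, n)) (A2 : 'M[R]_(q, n)) : 'M[R]_(p + (n + q)) :=
  block_mx (alpha + 1)%:M    (row_mx A1 0)
           (col_mx (- A1^T) 0) (block_mx S  0
                                         A2 (alpha + 1)%:M).

Definition BRS_Q (alpha : R) (S : 'M[R]_n) (A2 : 'M[R]_(q, n)) :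
    'M[R]_(p + (n + q)) :=
  block_mx alpha%:M 0
           0        (block_mx S (- A2^T)
                              0 alpha%:M).

Lemma BRS_splitting (alpha : R) (S : 'M[R]_n)
    (A1 : 'M[R]_(p, n)) (A2 : 'M[R]_(q, n)) :
  augmented_mx A1 A2 = BRS_P alpha S A1 A2 - BRS_Q alpha S A2.
Proof.
rewrite /augmented_mx /BRS_P /BRS_Q !opp_block_mx !add_block_mx.
by rewrite !oppr0 !addr0 !subrr opprK add0r -!raddfB /= addrAC subrr add0r.
Qed.

Definition BRS_G (alpha : R) (S : 'M[R]_n)
    (A1 : 'M[R]_(p, n)) (A2 : 'M[R]_(q, n)) : 'M[R]_(p + (n + q)) :=
  invmx (BRS_P alpha S A1 A2) *m BRS_Q alpha S A2.

Definition BRS_d (alpha : R) (S : 'M[R]_n)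
    (A1 : 'M[R]_(p, n)) (A2 : 'M[R]_(q, n))
    (b1 : 'cV[R]_p) (b2 : 'cV[R]_q) :
    'cV[R]_(p + (n + q)) :=
  invmx (BRS_P alpha S A1 A2) *m augmented_rhs b1 b2.

Definition BRS_iterate (alpha : R) (S : 'M[R]_n)
    (A1 : 'M[R]_(p, n)) (A2 : 'M[R]_(q, n))
    (b1 : 'cV[R]_p) (b2 : 'cV[R]_q)
    (u0 : 'cV[R]_(p + (n + q))) (k : nat) : 'cV[R]_(p + (n + q)) :=
  iter k (fun u => BRS_G alpha S A1 A2 *m u + BRS_d alpha S A1 A2 b1 b2) u0.

End BRS.

(* Main.v *)
Require Import Defs.
From mathcomp Require Import all_boot all_order all_algebra.
From mathcomp Require Import complex.
From mathcomp Require Import boolp classical_sets reals topology normedtype.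
From mathcomp Require Import interval_inference sequences ring lra.

Set Implicit Arguments.
Unset Strict Implicit.
Unset Printing Implicit Defensive.

Import Order.TTheory GRing.Theory Num.Theory.
Import numFieldNormedType.Exports.

Local Open Scope ring_scope.
Local Open Scope classical_set_scope.

(** Let P and Q be the two parts of the splitting and K = P - Q.  Everything
follows from one fact about the pencil: if t is a complex number with |t| <= 1
and P u = t Q u, then u = 0 ([BRS_pencil_inj]).  Taking t = 0 shows that P is
invertible, t = 1 that K is invertible, and t = 1/a that no a with |a| >= 1 is
an eigenvalue of the iteration matrix G = P^-1 Q.

To prove the fact, write u = (x, y, z).  The first and third block rows give
A1 y = - beta x and A2 y = - beta z with beta = alpha + 1 - t alpha, which is
nonzero since |t| <= 1.  Multiplying the middle row by beta eliminates x and z,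
and pairing it with y^* gives a + beta s = t (beta s + b), where
a = y^* A1^T A1 y, b = y^* A2^T A2 y and s = y^* S y are real because the
matrices are real symmetric.  In powers of t this reads
  ((1 + alpha) s + a) - ((1 + 2 alpha) s + b) t + alpha s t^2 = 0.
If y <> 0, then s > 0 and a > b >= 0, so that the coefficients c2, c1, c0
satisfy 0 <= c0 < c2 and 0 <= c1 < c2 + c0; these are the Schur conditions which
exclude roots in the closed unit disc ([quadratic_neq0]).  Hence y = 0, and then
x = z = 0.

Convergence needs the powers of a real matrix with all complex eigenvalues in
the open unit disc to tend to 0 ([cvg_iter_mulmx]).  By Cayley-Hamilton the
product of the factors M - z over the roots z of the characteristic polynomial
is 0, and removing these factors one at a time bounds |M^k v| by a multiple of
rho^k, for any rho exceeding all |z| ([geometric_decay]). *)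

Local Notation toC := (map_mx (real_complex _)).

(** * A quadratic without roots in the closed unit disc *)

(** With t = x + i y, the imaginary part of the equation is y (2 c0 x - c1), so
a root is either real or satisfies 2 c0 x = c1.  For a real root the case x <= 0
is excluded by signs, and for x > 0 the condition c1 < c2 + c0 makes the
quadratic larger than (1 - x) (c2 - c0 x) >= 0.  If 2 c0 x = c1, then the real
part of the quadratic is c2 - c0 |t|^2 > 0. *)
Lemma quadratic_neq0 (R : rcfType) (c0 c1 c2 : R) (t : R[i]) :
  `|t| <= 1 -> 0 <= c0 -> c0 < c2 -> 0 <= c1 -> c1 < c2 + c0 ->
  c2%:C%C - c1%:C%C * t + c0%:C%C * t ^+ 2 != 0.
Proof.
case: t => x y; rewrite normc_def /= => t1 c0_ge0 c02 c1_ge0 c1_lt.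
have {t1} xy1 : x ^+ 2 + y ^+ 2 <= 1.
  rewrite -[1]/(1%:C%C) lecR -sqrtr1 ler_sqrt ?ltr01// in t1.
apply/eqP => /eqP; rewrite eq_complex /= => /andP[/eqP re0 /eqP im0].
have : y * (2 * c0 * x - c1) = 0 by rewrite -[RHS]im0; ring.
have {}re0 : c2 - c1 * x + c0 * (x ^+ 2 - y ^+ 2) = 0.
  by rewrite -[RHS]re0; ring.
move=> /eqP; rewrite mulf_eq0 => /orP[/eqP y0|/eqP c1E].
  subst y.
  have c0x2 : 0 <= c0 * x ^+ 2 by rewrite mulr_ge0 // sqr_ge0.
  rewrite expr0n /= subr0 in re0; rewrite expr0n /= addr0 in xy1.
  have [x0|x0] := lerP x 0.
    have : c1 * x <= 0 by rewrite mulr_ge0_le0.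
    by lra.
  have x1 : x <= 1 by rewrite -(ler_pXn2r (n := 2)) ?nnegrE ?expr1n // ltW.
  have : (c2 + c0 - c1) * x > 0 by rewrite mulr_gt0 // subr_gt0.
  have : (1 - x) * (c2 - c0 * x) >= 0.
    rewrite mulr_ge0 ?subr_ge0 //; apply: le_trans (ltW c02).
    by rewrite ler_piMr.
  by lra.
have : c0 * (1 - (x ^+ 2 + y ^+ 2)) >= 0 by rewrite mulr_ge0 // subr_ge0.
nra.
Qed.

(** * Hermitian forms of real symmetric matrices *)

Definition herm_form (R : rcfType) n (M : 'M[R]_n) (y : 'cV[R[i]]_n) : R[i] :=
  ((map_mx (@complex.conjc R) y)^T *m toC M *m y) 0 0.

(** The cross terms between the real and imaginary parts cancel because M is
symmetric; this is what makes the coefficients of the quadratic real. *)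
Lemma herm_form_realsym (R : rcfType) n (M : 'M[R]_n) (y : 'cV[R[i]]_n) :
  M^T = M ->
  let x1 := map_mx (@complex.Re R) y in let x2 := map_mx (@complex.Im R) y in
  herm_form M y =
  ((x1^T *m M *m x1 + x2^T *m M *m x2) 0 0)%:C%C.
Proof.
move=> Msym x1 x2; rewrite /herm_form.
have yE : y = toC x1 + 'i%C *: toC x2.
  by apply/matrixP => i j; rewrite !mxE [LHS]complexE.
have yJ : map_mx (@complex.conjc R) y = toC x1 - 'i%C *: toC x2.
  apply/matrixP => i j; rewrite !mxE; case: (y i j) => a b /=.
  by apply/eqP; rewrite eq_complex /=; apply/andP; split; apply/eqP; ring.
clearbody x1 x2.
have cross : x2^T *m M *m x1 = x1^T *m M *m x2.
  transitivity (x2^T *m M *m x1)^T.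
    by apply/matrixP => i j; rewrite [RHS]mxE !ord1.
  by rewrite !trmx_mul trmxK Msym mulmxA.
rewrite yJ yE [in LHS]linearB /= [in LHS]linearZ /= !map_trmx.
rewrite !mulmxBl !mulmxDr -!scalemxAl -!scalemxAr -!map_mxM cross.
rewrite !mxE /=.
by apply/eqP; rewrite eq_complex /=; apply/andP; split; apply/eqP; ring.
Qed.

Lemma herm_form_posdef (R : realType) n (M : 'M[R]_n) (y : 'cV[R[i]]_n) :
  sym_posdef M -> y != 0 -> exists2 s : R, 0 < s & herm_form M y = s%:C%C.
Proof.
move=> [Msym Mpos] y0.
have {}Msym : M^T = M.
  by rewrite (trmx_sesqui Msym) expr0 scale1r map_mx_id.
rewrite herm_form_realsym //; eexists; last by [].
have Mge0 (x : 'cV[R]_n) : 0 <= (x^T *m M *m x) 0 0.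
  by have [->|/Mpos/ltW//] := eqVneq x 0; rewrite mulmx0 mxE.
rewrite mxE lt0r addr_ge0 // andbT paddr_eq0 //; apply/negP => /andP[].
move=> /eqP q1 /eqP q2; case/negP: y0; apply/eqP/matrixP => i j.
have x0 (x : 'cV[R]_n) : (x^T *m M *m x) 0 0 = 0 -> x = 0.
  by have [//|/Mpos] := eqVneq x 0; rewrite lt0r => /andP[/eqP].
have /matrixP/(_ i j) := x0 _ q1; have /matrixP/(_ i j) := x0 _ q2.
by rewrite !mxE; case: (y i j) => a b /= -> ->.
Qed.

Lemma herm_form_gram (R : rcfType) m n (A : 'M[R]_(m, n)) (y : 'cV[R[i]]_n) :
  exists2 b : R, 0 <= b & herm_form (A^T *m A) y = b%:C%C.
Proof.
have gram_ge0 (x : 'cV[R]_n) : 0 <= (x^T *m (A^T *m A) *m x) 0 0.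
  rewrite mulmxA -mulmxA -trmx_mul mxE sumr_ge0 // => i _.
  by rewrite mxE -expr2 sqr_ge0.
rewrite herm_form_realsym; last by rewrite trmx_mul trmxK.
by eexists; last by []; rewrite mxE addr_ge0.
Qed.

Lemma herm_formD (R : rcfType) n (M N : 'M[R]_n) (y : 'cV[R[i]]_n) :
  herm_form (M + N) y = herm_form M y + herm_form N y.
Proof. by rewrite /herm_form map_mxD mulmxDr mulmxDl mxE. Qed.

(** * Matrices with all eigenvalues in the open unit disc *)

Lemma unitmx_colP (F : fieldType) n (A : 'M[F]_n) :
  (forall u : 'cV_n, A *m u = 0 -> u = 0) -> A \in unitmx.
Proof.
move=> injA; rewrite unitmxE unitfE -det_tr; apply/det0P => -[v v0 vA0].
case/eqP: v0; apply: trmx_inj; rewrite trmx0; apply: injA.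
by apply: trmx_inj; rewrite trmx_mul trmxK vA0 trmx0.
Qed.

(** Induction on the roots: w = (M - z) v is annihilated by the remaining
factors, so |M^k w| <= C rho^k, and M^(k+1) v = z M^k v + M^k w.  The bound
D rho^k propagates through this recurrence as soon as |z| D + C <= rho D, which
is possible because |z| < rho; repeated roots need no special treatment. *)
Lemma geometric_decay (F : numFieldType) n (M : 'M[F]_n.+1) (rho : F)
    (r : seq F) (v : 'cV[F]_n.+1) :
  0 < rho -> {in r, forall z, `|z| < rho} ->
  horner_mx M (\prod_(z <- r) ('X - z%:P)) *m v = 0 ->
  exists2 C, 0 <= C & forall k, `|M ^+ k *m v| <= C * rho ^+ k.
Proof.
move=> rho_gt0; elim: r v => [|z r IH] v zr.
  rewrite big_nil rmorph1 mul1mx => ->.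
  by exists 0 => // k; rewrite mulmx0 normr0 mul0r.
rewrite big_cons mulrC rmorphM /= rmorphB /= horner_mx_X horner_mx_C.
rewrite -mulmxA => /IH[y yr|C C_ge0 Cw].
  by apply: zr; rewrite inE yr orbT.
have z_lt : 0 < rho - `|z| by rewrite subr_gt0 zr ?mem_head.
(* the second summand absorbs the forcing term, the first one starts the
   induction at k = 0 *)
set D := `|v| + C / (rho - `|z|).
have D_ge0 : 0 <= D by rewrite addr_ge0 // divr_ge0 // ltW.
exists D => //; elim=> [|k IHk].
  by rewrite expr0 mul1mx expr0 mulr1 lerDl divr_ge0 // ltW.
have -> : M ^+ k.+1 *m v = z *: (M ^+ k *m v) + M ^+ k *m ((M - z%:M) *m v).
  rewrite mulmxBl mul_scalar_mx mulmxBr -scalemxAr addrC subrK.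
  by rewrite exprSr -mulmxA.
have Cle : C <= D * (rho - `|z|).
  by rewrite mulrDl divfK ?gt_eqF // lerDr mulr_ge0 // ltW.
apply: le_trans (ler_normD _ _) _; rewrite mx_normZ.
have -> : D * rho ^+ k.+1 =
    `|z| * (D * rho ^+ k) + D * (rho - `|z|) * rho ^+ k by rewrite exprS; ring.
apply: lerD; first exact: ler_wpM2l.
by apply: le_trans (Cw k) _; rewrite ler_wpM2r // exprn_ge0 // ltW.
Qed.

(** There are finitely many eigenvalues, so a strict bound on each of them
leaves a uniform gap; both the supremum defining the spectral radius and the
rate of convergence depend on this gap. *)
Lemma eigenvalues_lt1_bound (R : realType) k (M : 'M[R]_k) :
  (forall a, eigenvalue (toC M) a -> `|a| < 1) ->
  exists rho : R, [/\ 0 < rho, rho < 1 &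
    forall a, eigenvalue (toC M) a -> `|a| < rho%:C%C].
Proof.
move=> lt1; have [r rE] := closed_field_poly_normal (char_poly (toC M)).
have eigE a : eigenvalue (toC M) a = (a \in r).
  rewrite eigenvalue_root_char rE (monicP (char_poly_monic _)) scale1r.
  by rewrite root_prod_XsubC.
have {}lt1 : {in r, forall a, `|a| < 1} by move=> a; rewrite -eigE => /lt1.
suff [rho [rho0 rho1 rhor]] : exists rho : R, [/\ 0 < rho, rho < 1 &
    {in r, forall a, `|a| < rho%:C%C}].
  by exists rho; split=> // a; rewrite eigE => /rhor.
elim: {eigE rE} r lt1 => [|z r IH] lt1; first by exists 2^-1; split => //; lra.
have [y yr|rho [rho0 rho1 rhor]] := IH.
  by apply: lt1; rewrite inE yr orbT.
have := lt1 z (mem_head _ _); rewrite normc_def; set m := Num.sqrt _ => m1.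
have {}m1 : m < 1 by rewrite -ltcR.
exists (Num.max rho ((m + 1) / 2)); split.
- by rewrite lt_max rho0.
- by rewrite gt_max rho1 /=; lra.
- move=> a; rewrite inE => /orP[/eqP ->|/rhor ar].
    rewrite normc_def -/m ltcR lt_max; apply/orP; right; lra.
  by apply: lt_le_trans ar _; rewrite lecR le_max lexx.
Qed.

Lemma spectral_radius_lt1 (R : realType) k (M : 'M[R]_k) :
  (forall a, eigenvalue (toC M) a -> `|a| < 1) -> spectral_radius M < 1.
Proof.
move=> /eigenvalues_lt1_bound[rho [rho0 rho1 rhoM]].
rewrite /spectral_radius; set E := [set _ | _].
(* only a matrix of size 0 has no eigenvalue; the supremum is then 0 *)
have [->|E0] := eqVneq E set0; first by rewrite sup0 ltr01.
apply: le_lt_trans rho1; apply: ge_sup; first exact/set0P.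
by move=> _ [a /rhoM a_lt ->]; rewrite ltW // -ltcR.
Qed.

(** Transfers the decay obtained over the complex numbers back to real vectors. *)
Lemma le_mx_norm_toC (R : realType) m n (A : 'M[R]_(m, n)) :
  `|A|%:C%C <= `|toC A|.
Proof.
have [->|/mx_norm_neq0[[i j] Aij]] := eqVneq `|A| 0; first exact: normr_ge0.
have -> : `|A| = `|A i j| by exact: Aij.
have -> : `|A i j|%:C%C = `|toC A i j|.
  by rewrite mxE normc_def /= expr0n addr0 sqrtr_sqr.
rewrite {2}/Num.norm /= /mx_norm -[`|toC A i j|]nngE num_le.
exact: (le_bigmax _ _ (i, j)).
Qed.

Lemma cvg_iter_mulmx (R : realType) n (M : 'M[R]_n) (v : 'cV[R]_n) :
  (forall a, eigenvalue (toC M) a -> `|a| < 1) ->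
  (fun k => iter k (mulmx M) v) @ \oo --> (0 : 'cV[R]_n).
Proof.
(* polynomials can be evaluated only at matrices of positive size *)
case: n M v => [|n] M v lt1.
  rewrite (_ : (fun k => _) = fun=> 0); first exact: cvg_cst.
  by apply/funext => k; rewrite flatmx0.
have [rho [rho0 rho1 rhoM]] := eigenvalues_lt1_bound lt1.
have [r rE] := closed_field_poly_normal (char_poly (toC M)).
rewrite (monicP (char_poly_monic _)) scale1r in rE.
have [|z zr||C C_ge0 Ck] := @geometric_decay _ _ (toC M) rho%:C%C r (toC v).
- by rewrite ltcR.
- by apply: rhoM; rewrite eigenvalue_root_char rE root_prod_XsubC.
- by rewrite -rE Cayley_Hamilton mul0mx.
have CE : C = (complex.Re C)%:C%C by rewrite RRe_real // ger0_real.
have bound k : `|iter k (mulmx M) v| <= geometric (complex.Re C) rho k.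
  rewrite -lecR; apply: le_trans (le_mx_norm_toC _) _.
  rewrite /geometric /= rmorphM rmorphXn /= -CE.
  suff -> : toC (iter k (mulmx M) v) = toC M ^+ k *m toC v by exact: Ck.
  elim: k => [|k IHk]; first by rewrite expr0 mul1mx.
  by rewrite /= map_mxM IHk exprS -mulmxA.
apply/norm_cvg0P.
apply: (@squeeze_cvgr _ _ _ _ (fun=> 0) (geometric (complex.Re C) rho)).
- by apply: nearW => k; rewrite normr_ge0 bound.
- exact: cvg_cst.
- by apply: cvg_geometric; rewrite gtr0_norm.
Qed.

(** * The pencil of the splitting *)

(** Stating injectivity for the pencil, rather than bounding the eigenvalues of
G, avoids inverting P before it is known to be invertible, and covers P, K and
the eigenvalue problem at once. *)
Lemma BRS_pencil_inj (R : realType) p n q (A1 : 'M[R]_(p, n))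
    (A2 : 'M[R]_(q, n)) (alpha : R) (S : 'M[R]_n) (t : R[i])
    (u : 'cV[R[i]]_(p + (n + q))) :
  sym_posdef (A1^T *m A1 - A2^T *m A2) -> 0 < alpha -> sym_posdef S ->
  `|t| <= 1 ->
  toC (BRS_P alpha S A1 A2) *m u = t *: (toC (BRS_Q p alpha S A2) *m u) ->
  u = 0.
Proof.
move=> Jpd alpha_gt0 Spd t1.
rewrite -[u]vsubmxK -[dsubmx u]vsubmxK.
move: (usubmx u) (usubmx (dsubmx u)) (dsubmx (dsubmx u)) => x y z {u}.
rewrite /BRS_P /BRS_Q !(map_block_mx, map_row_mx, map_col_mx).
rewrite !(mul_block_col, mul_row_col, mul_col_mx, add_col_mx, scale_col_mx).
rewrite !(raddf0, mul0mx, addr0, add0r, raddfN, map_scalar_mx, mul_scalar_mx) /=.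
move=> /eq_col_mx[e1]; rewrite scale_col_mx => /eq_col_mx[e2 e3].
set beta : R[i] := (alpha + 1)%:C%C - t * alpha%:C%C.
have beta0 : beta != 0.
  rewrite subr_eq0; apply/eqP => /(congr1 Num.norm); apply/eqP.
  have norm_real (c : R) : 0 < c -> `|c%:C%C| = c%:C%C.
    by move=> c0; rewrite gtr0_norm // ltcR.
  rewrite normrM !norm_real //; last by lra.
  rewrite gt_eqF //; apply: (@le_lt_trans _ _ alpha%:C%C).
    by rewrite ler_piMl // lecR ltW.
  by rewrite ltcR; lra.
have {}e1 : toC A1 *m y = - beta *: x.
  by rewrite scaleNr scalerBl -scalerA -e1 opprB addrAC subrr add0r.
have {}e3 : toC A2 *m y = - beta *: z.
  by rewrite scaleNr scalerBl -scalerA -e3 opprB addrK.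
have [y0|y0] := eqVneq y 0.
  have beta_inj m (w : 'cV[R[i]]_m) : 0 = - beta *: w -> w = 0.
    by move/esym/eqP; rewrite scaler_eq0 oppr_eq0 (negPf beta0) => /eqP.
  have -> : x = 0 by apply: beta_inj; rewrite -e1 y0 mulmx0.
  have -> : z = 0 by apply: beta_inj; rewrite -e3 y0 mulmx0.
  by rewrite y0 !col_mx0.
(* the middle row times beta, where beta x and beta z have been replaced
   through the outer rows, paired with y^* *)
have {e1 e2 e3} : herm_form (A1^T *m A1) y + beta * herm_form S y =
    t * (beta * herm_form S y + herm_form (A2^T *m A2) y).
  move/(congr1 (fun w => (map_mx (@complex.conjc R) y)^T *m (beta *: w))): e2.
  have gramE m (B : 'M[R]_(m, n)) w : toC B *m y = - beta *: w ->
    beta *: - (toC B^T *m w) = toC (B^T *m B) *m y.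
    by move=> Bw; rewrite map_mxM -mulmxA Bw -scalemxAr scaleNr scalerN.
  rewrite scalerDr mulNmx (gramE _ _ _ e1) scalerA mulrC -scalerA scalerDr.
  rewrite mulNmx (gramE _ _ _ e3) -scalemxAr.
  rewrite !mulmxDr -!scalemxAr !mulmxA => /matrixP/(_ 0 0).
  have addE (M N : 'M[R[i]]_1) : (M + N) 0 0 = M 0 0 + N 0 0 by rewrite mxE.
  have scaleE c (M : 'M[R[i]]_1) : (c *: M) 0 0 = c * M 0 0 by rewrite mxE.
  by rewrite !(addE, scaleE).
have -> : A1^T *m A1 = (A1^T *m A1 - A2^T *m A2) + A2^T *m A2 by rewrite subrK.
rewrite herm_formD.
have [d d_gt0 ->] := herm_form_posdef Jpd y0.
have [s s_gt0 ->] := herm_form_posdef Spd y0.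
have [b b_ge0 ->] := herm_form_gram A2 y.
move=> /eqP; rewrite -subr_eq0 => E.
have sa : 0 < alpha * s by rewrite mulr_gt0.
suff /eqP[] : ((1 + alpha) * s + (d + b))%:C%C -
    ((1 + 2 * alpha) * s + b)%:C%C * t + (alpha * s)%:C%C * t ^+ 2 != 0.
  rewrite -[RHS](eqP E) /beta !(rmorphD, rmorphM, rmorph1, rmorph_nat) /=.
  by ring.
by apply: quadratic_neq0 => //; lra.
Qed.

(** * Convergence of the BRS iteration *)

Theorem theorem1 (R : realType) (p n q : nat)
    (A1 : 'M[R]_(p, n)) (A2 : 'M[R]_(q, n)) (b1 : 'cV[R]_p) (b2 : 'cV[R]_q)
    (A1_rank : \rank A1 = n)
    (AJA_posdef : sym_posdef (A1^T *m A1 - A2^T *m A2))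
    (alpha : R) (alpha_gt0 : 0 < alpha)
    (S : 'M[R]_n) (S_posdef : sym_posdef S) :
  [/\ BRS_P alpha S A1 A2 \in unitmx,
      spectral_radius (BRS_G alpha S A1 A2) < 1 &
      exists2 u : 'cV[R]_(p + (n + q)),
        augmented_mx A1 A2 *m u = augmented_rhs n b1 b2 &
        forall u0 : 'cV[R]_(p + (n + q)),
          BRS_iterate alpha S A1 A2 b1 b2 u0 @ \oo --> u].
Proof.
set P := BRS_P alpha S A1 A2; set Q := BRS_Q p alpha S A2.
set G := BRS_G alpha S A1 A2.
have pencil (t : R[i]) (u : 'cV[R[i]]_(p + (n + q))) :
    `|t| <= 1 -> toC P *m u = t *: (toC Q *m u) -> u = 0.
  exact: (BRS_pencil_inj AJA_posdef alpha_gt0 S_posdef).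
have toC_inj k (u : 'cV[R]_k) : toC u = 0 -> u = 0.
  by move/eqP; rewrite map_mx_eq0 => /eqP.
have P_unit : P \in unitmx.
  apply: unitmx_colP => u Pu0; apply: toC_inj; apply: (pencil 0).
    by rewrite normr0 ler01.
  by rewrite scale0r -map_mxM Pu0 map_mx0.
have K_unit : augmented_mx A1 A2 \in unitmx.
  apply: unitmx_colP => u; rewrite (BRS_splitting alpha S) mulmxBl.
  move=> /eqP; rewrite subr_eq0 => /eqP PQu.
  apply: toC_inj; apply: (pencil 1); first by rewrite normr1.
  by rewrite scale1r -!map_mxM PQu.
have PG : P *m G = Q by rewrite mulKVmx.
(* [eigenvalue] provides a left eigenvector, whereas the pencil acts on columns:
   injectivity on columns makes G - a invertible, which kills the former *)
have eig_lt1 a : eigenvalue (toC G) a -> `|a| < 1.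
  move=> /eigenvalueP[v vG v0]; rewrite real_ltNge ?normr_real ?real1 //.
  apply: contra_neqN v0 => a_ge1.
  have a0 : a != 0 by apply: contraTneq a_ge1 => ->; rewrite normr0 ler10.
  suff Ga_unit : toC G - a%:M \in unitmx.
    apply: (can_inj (mulmxK Ga_unit)).
    by rewrite mul0mx mulmxBr vG mul_mx_scalar subrr.
  apply: unitmx_colP => u; rewrite mulmxBl mul_scalar_mx => /eqP.
  rewrite subr_eq0 => /eqP Gu; apply: (pencil a^-1).
    by rewrite normfV invf_le1 // normr_gt0.
  by rewrite -PG map_mxM -mulmxA Gu -scalemxAr scalerA mulVf // scale1r.
split=> //; first exact: spectral_radius_lt1.
set rhs := augmented_rhs n b1 b2.
pose u := invmx (augmented_mx A1 A2) *m rhs.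
have Ku : augmented_mx A1 A2 *m u = rhs by rewrite mulKVmx.
exists u => // u0.
have u_fix : u = G *m u + BRS_d alpha S A1 A2 b1 b2.
  rewrite /BRS_d -/rhs -Ku (BRS_splitting alpha S) mulmxBl mulmxBr.
  by rewrite mulKmx // [RHS]addrC mulmxA subrK.
(* the error obeys the homogeneous iteration *)
have iterE k : BRS_iterate alpha S A1 A2 b1 b2 u0 k =
    iter k (mulmx G) (u0 - u) + u.
  elim: k => [|k IHk]; first by rewrite subrK.
  rewrite /BRS_iterate /= -/(BRS_iterate _ _ _ _ _ _ _ _) IHk.
  by rewrite mulmxDr -addrA -u_fix.
rewrite (_ : BRS_iterate _ _ _ _ _ _ _ =
    fun k => iter k (mulmx G) (u0 - u) + u); last exact/funext.
rewrite -[X in _ --> X]add0r; apply: cvgD; last exact: cvg_cst.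
exact: cvg_iter_mulmx.
Qed.
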